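(* A Urysohn space $X$ is minimal Urysohn ($MU$) if and only if $X$ is $U$-closed and the following holds: for every infinite set $A\subseteq X$ and every point $x\in X$, if $A$ does not $\theta(2)$-converge to $X\setminus\{x\}$, then $x$ is a complete accumulation point of $A$.
   Context: $\overline{M}=\mathrm{cl}\,M$ is the closure in the space $X$. A space is Urysohn if any two distinct points have neighborhoods with disjoint closures. A Urysohn space is $U$-closed if it is closed in every Urysohn space containing it as a subspace. A Urysohn space is $MU$ (minimal Urysohn) if its underlying set carries no strictly coarser Urysohn topology. $\theta$-closure: $x\notin \mathrm{cl}_{\theta}M$ iff there is an open neighborhood $U$ of $x$ with $\mathrm{cl}\,U\cap M=\emptyset$. The $\theta$-interior is $\mathrm{Int}_{\theta}M=X\setminus \mathrm{cl}_{\theta}(X\setminus M)$. An $S(1)$-cover of a subset $B\subseteq X$ is a family $\{U_\alpha\}$ of open subsets of $X$ such that $B\subseteq\bigcup_\alpha \mathrm{Int}_{\theta}U_\alpha$. A set $A$ $\theta(2)$-converges to a set $B$ if for every $S(1)$-cover $\gamma$ of $B$ there is a finite family $\{U_{\alpha_i}\}_{i=1}^k\subseteq\gamma$ such that $|A\setminus \bigcup_{i=1}^k\overline{U_{\alpha_i}}|<|A|$. A point $x$ is a complete accumulation point of an infinite set $F$ if $|F\cap U|=|F|$ for every open neighborhood $U$ of $x$. *)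

(* Defs.v *)
From mathcomp Require Import all_boot all_classical topology.

Set Implicit Arguments.
Unset Strict Implicit.
Unset Printing Implicit Defensive.

Local Open Scope classical_set_scope.
Local Open Scope card_scope.

Definition urysohn_space (X : topologicalType) : Prop :=
  forall x y : X, x <> y ->
    exists U V : set X,
      [/\ nbhs x U, nbhs y V & closure U `&` closure V = set0].

Definition topological_embedding (X Y : topologicalType) (f : X -> Y) : Prop :=
  injective f /\
  forall U : set X, open U <-> exists2 V : set Y, open V & f @^-1` V = U.

(* A space containing X as a subspace is given by an embedding X -> Y. *)
Definition U_closed (X : topologicalType) : Prop :=
  urysohn_space X /\
  forall (Y : topologicalType) (f : X -> Y),
    urysohn_space Y -> topological_embedding f -> closed (range f).

(* c ranges over the topologies on the underlying set of X. Such a class also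
   packs a choice structure on X, which no topological notion depends on. *)
Definition minimal_urysohn (X : topologicalType) : Prop :=
  urysohn_space X /\
  ~ exists c : Topological X,
      urysohn_space (Topological.Pack c) /\
      (@open (Topological.Pack c) : set (set X)) `<` @open X.

Definition theta_closure (X : topologicalType) (M : set X) : set X :=
  [set x | ~ exists2 U : set X, open_nbhs x U & closure U `&` M = set0].

Definition theta_interior (X : topologicalType) (M : set X) : set X :=
  ~` theta_closure (~` M).

Definition S1_cover (X : topologicalType) (gamma : set (set X)) (B : set X)
    : Prop :=
  gamma `<=` open /\ B `<=` \bigcup_(U in gamma) theta_interior U.

Definition card_lt (T U : Type) (A : set T) (B : set U) : Prop :=
  A #<= B /\ A #!= B.

Definition theta2_converges (X : topologicalType) (A B : set X) : Prop :=
  forall gamma : set (set X), S1_cover gamma B ->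
    exists D : set (set X),
      [/\ finite_set D, D `<=` gamma
        & card_lt (A `\` \bigcup_(U in D) closure U) A].

Definition complete_accumulation_point (X : topologicalType) (F : set X) (x : X)
    : Prop :=
  infinite_set F /\ forall U : set X, open_nbhs x U -> F `&` U #= F.

(* Main.v *)
(* Both implications rest on coarsening a Urysohn topology at one point [x]:
   the neighbourhoods of [x] are cut down to those that also belong to a filter
   [F] such that every other point has a neighbourhood whose closure misses the
   closure of some open member of [F].  The result is still Urysohn, so in a
   minimal Urysohn space such an [F] converges to [x].  Applied to the trace of
   the neighbourhoods of a limit point outside [X] this gives U-closedness, and
   applied to the complements of finite unions of closures from an S(1)-cover it
   gives complete accumulation.

   Conversely, if [U] is an open neighbourhood of [x] that is no neighbourhood
   in a coarser Urysohn topology, the complements of the coarse closures of the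
   coarse neighbourhoods of [x] form an S(1)-cover of the complement of [x].
   Remove finitely many closures of its members from the complement of [U] so
   that the remainder [A] has least cardinality: [A] then does not
   theta(2)-converge, although it misses [U]. *)
Require Import Defs.
From HB Require Import structures.
From mathcomp Require Import all_boot all_classical topology.

Set Implicit Arguments.
Unset Strict Implicit.
Unset Printing Implicit Defensive.

Local Open Scope classical_set_scope.
Local Open Scope card_scope.

(* Take a maximal set [S] of choice functions on [E] that take distinct values at
   every member of [E]; by maximality some [A] in [E] consists of values of [S],
   and [S] embeds into every other member. *)
Lemma exists_least_card (T : Type) (E : set (set T)) :
  E !=set0 -> exists2 A, E A & forall B, E B -> A #<= B.
Proof.
move=> E0.
pose P : set (set (set T -> T)) := [set S : set (set T -> T) |
  (forall s B, S s -> E B -> B (s B)) /\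
  (forall B, E B -> {in S &, injective (fun s : set T -> T => s B)})].
have [F FP Ftot|S [[Sval Sinj] Smax]] := @Zorn_bigcup (set T -> T) P.
  split=> [s B [S FS Ss] EB|B EB s t].
    by have [FSval _] := FP _ FS; exact: (FSval s B Ss EB).
  rewrite !inE => -[S FS Ss] [S' FS' S't] st.
  have [SS'|S'S] := Ftot _ _ FS FS'.
    have [_ /(_ B EB) FSinj] := FP _ FS'.
    by apply: FSinj; rewrite ?inE//; exact: SS'.
  have [_ /(_ B EB) FSinj] := FP _ FS.
  by apply: FSinj; rewrite ?inE//; exact: S'S.
suff [A EA AS] : exists2 A, E A & A `<=` (@^~ A) @` S.
  exists A => // B EB; apply: (card_le_trans (subset_card_le AS)).
  apply: (card_le_trans (card_image_le _ _)).
  have /card_eqPle[_ SB] := inj_card_eq (Sinj B EB).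
  apply: (card_le_trans SB); apply: subset_card_le => _ [s Ss <-].
  exact: (Sval s B Ss EB).
apply: contrapT => /forall2NP nosurj.
have missing B : E B -> exists b, B b /\ ~ ((@^~ B) @` S) b.
  by move=> EB; have [//|/existsNP[b /not_implyP]] := nosurj B; exists b.
have [A0 EA0] := E0; have [t0 _] := missing A0 EA0.
have [B|g gP] := @choice _ _ (fun B b => E B -> B b /\ ~ ((@^~ B) @` S) b).
  by have [/missing[b ?]|nEB] := pselect (E B); [exists b|exists t0].
apply: (Smax (S `|` [set g])).
  split; first by move=> s Ss; left.
  move=> /(_ g (or_intror erefl)) Sg.
  by have [_] := gP A0 EA0; apply; exists g.
split=> [s B [Ss|->] EB|B EB s t]; first exact: (Sval s B Ss EB).
  by have [] := gP B EB.
have [_ gS] := gP B EB.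
rewrite !inE => -[Ss|->] [St|->] // st.
- by apply: (Sinj B EB) => //; rewrite inE.
- by case: gS; exists s.
- by case: gS; exists t.
Qed.

(** * Coarsening a Urysohn topology at one point *)

(** A copy of the carrier of [X] whose type records [x] and the filter, so that the coarser topology
    can be declared on it without clashing with that of [X]. *)
Definition coarsening (X : topologicalType) (x : X) (F : set_system X)
    (FF : Filter F) : Type := X.

Section Coarsening.
Variables (X : topologicalType) (x : X) (F : set_system X) (FF : Filter F).

HB.instance Definition _ := Choice.on (coarsening x FF).

Definition coarsening_open : set_system (coarsening x FF) :=
  [set O | @open X O /\ (O x -> F O)].

Lemma coarsening_openT : coarsening_open setT.
Proof. by split=> [|_]; [exact: openT|exact: filterT]. Qed.

Lemma coarsening_openI : setI_closed coarsening_open.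
Proof.
move=> A B [oA FA] [oB FB]; split; first exact: openI.
by move=> [/FA ? /FB ?]; exact: filterI.
Qed.

Lemma coarsening_open_bigcup (I : Type) (f : I -> set (coarsening x FF)) :
  (forall i, coarsening_open (f i)) -> coarsening_open (\bigcup_i f i).
Proof.
move=> fo; split; first by apply: bigcup_open => i _; exact: (fo i).1.
move=> [i _ fix_]; apply: (@filterS _ _ _ (f i)); last exact: (fo i).2.
exact: bigcup_sup.
Qed.

HB.instance Definition _ := isOpenTopological.Build (coarsening x FF)
  coarsening_openT coarsening_openI coarsening_open_bigcup.

Local Notation Y := (coarsening x FF).

Lemma open_coarseningE : (@open Y : set_system X) = coarsening_open.
Proof. by []. Qed.

Hypothesis urysohnX : urysohn_space X.

(** A point other than [x] has small open neighbourhoods that avoid [x], and these stay open. Hence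
    coarsening can add only [x] to a closure. *)
Lemma closure_coarsening (B : set X) :
  @closure Y B `<=` closure B `|` [set x].
Proof.
move=> p clp; have [->|px] := pselect (p = x); [by right|left=> N].
rewrite nbhsE => -[O [oO Op] ON].
have [U [V [Up Vx UV]]] := urysohnX px.
have /clp[q [Bq [Oq _]]] : @nbhs _ Y p (O `&` U°).
  apply: (@open_nbhs_nbhs Y); split.
    rewrite open_coarseningE; split.
      by apply: openI => //; exact: open_interior.
    move=> [_ /interior_subset Ux]; exfalso.
    suff : (closure U `&` closure V) x by rewrite UV.
    by split; apply: subset_closure => //; exact: nbhs_singleton.
  by split.
by exists q; split=> //; exact: ON.
Qed.

Hypothesis Fsep : forall y, y <> x -> exists W V,
  [/\ open_nbhs y W, open V, F V & closure W `&` closure V = set0].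

Lemma coarsening_separation (y : X) : y <> x -> exists N G : set X,
  [/\ @open_nbhs Y y N, @open_nbhs Y x G, @closure Y N `<=` closure N,
      @closure Y G `<=` closure G & closure N `&` closure G = set0].
Proof.
move=> yx.
have [W [V [[oW Wy] oV FV WV]]] := Fsep yx.
have [A [B [Ay Bx AB]]] := urysohnX yx.
(* [V] puts [G] into [F] and [B°] puts [x] into [G], so [G] is a coarse neighbourhood of [x]. It
   misses [N], so neither closure gains [x]: [N] is kept away from it and [G] already contains
   it. *)
pose N := W `&` A°; pose G := V `|` B°.
have NG : closure N `&` closure G = set0.
  rewrite -subset0 => p [Np]; rewrite closureU => -[Vp|Bp].
    by rewrite -WV; split=> //; apply: closureS Np; exact: subIsetl.
  rewrite -AB; split; last by apply: closureS Bp; exact: interior_subset.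
  by apply: closureS Np => q [_ /interior_subset].
have Gx : G x by right.
have nNx : ~ N x.
  move=> Nx; suff : (closure N `&` closure G) x by rewrite NG.
  by split; exact: subset_closure.
have oN : @open_nbhs Y y N.
  split=> //; rewrite open_coarseningE; split=> //.
  by apply: openI => //; exact: open_interior.
have oG : @open_nbhs Y x G.
  split=> //; rewrite open_coarseningE; split.
    by apply: openU => //; exact: open_interior.
  by move=> _; apply: filterS FV; exact: subsetUl.
exists N, G; split=> // p clp.
  have [//|px] := closure_coarsening clp.
  have [|q [Nq Gq]] := clp G; first by rewrite px; exact: open_nbhs_nbhs.
  suff : (closure N `&` closure G) q by rewrite NG.
  by split; exact: subset_closure.
have [//|->] := closure_coarsening clp.
exact: subset_closure.
Qed.

Lemma urysohn_coarsening : urysohn_space Y.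
Proof.
move=> y z yz.
have [yx|yx] := pselect (y = x).
  have zx : z <> x by move=> zx; apply: yz; rewrite yx.
  have [N [G [oN oG clN clG NG]]] := coarsening_separation zx.
  exists G, N; split; [|exact: open_nbhs_nbhs|].
    by rewrite yx; exact: open_nbhs_nbhs.
  by rewrite -subset0 => p [/clG ? /clN ?]; rewrite -NG.
have [N [G [oN oG clN clG NG]]] := coarsening_separation yx.
have [zx|zx] := pselect (z = x).
  exists N, G; split; [exact: open_nbhs_nbhs| |].
    by rewrite zx; exact: open_nbhs_nbhs.
  by rewrite -subset0 => p [/clN ? /clG ?]; rewrite -NG.
have [N' [G' [oN' oG' clN' _ NG']]] := coarsening_separation zx.
have [A [B [Ay Bz AB]]] := urysohnX yz.
(* With both points different from [x], intersecting with [M] keeps [x] out of the coarse closure,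
   which then stays within [closure C]. *)
have shrink (M H C : set X) (w : X) : @open_nbhs Y w M -> @open_nbhs Y x H ->
    closure M `&` closure H = set0 -> nbhs w C ->
    @nbhs _ Y w (M `&` C°) /\ @closure Y (M `&` C°) `<=` closure C.
  move=> [oM Mw] oH MH Cw.
  have MHq q : M q -> H q -> False.
    move=> Mq Hq; suff : (closure M `&` closure H) q by rewrite MH.
    by split; exact: subset_closure.
  split.
    apply: (@open_nbhs_nbhs Y); split=> //; rewrite open_coarseningE; split.
      by apply: openI; [exact: oM.1|exact: open_interior].
    by move=> [/MHq/(_ oH.2)].
  move=> p clp; have [|px] := closure_coarsening clp.
    by apply: closureS => q [_ /interior_subset].
  have [|q [[/MHq Hq _] /Hq//]] := clp H.
  by rewrite px; exact: open_nbhs_nbhs.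
have [NA clNA] := shrink _ _ _ _ oN oG NG Ay.
have [NB clNB] := shrink _ _ _ _ oN' oG' NG' Bz.
exists (N `&` A°), (N' `&` B°); split=> //.
by rewrite -subset0 => p [/clNA ? /clNB ?]; rewrite -AB.
Qed.

End Coarsening.

(* If [F] did not converge to [x], then letting [x] keep only those open
   neighbourhoods that belong to [F] would give a strictly coarser Urysohn
   topology. *)
Lemma minimal_urysohn_cvg (X : topologicalType) (x : X) (F : set_system X) :
  Filter F -> minimal_urysohn X ->
  (forall y, y <> x -> exists W V,
    [/\ open_nbhs y W, open V, F V & closure W `&` closure V = set0]) ->
  F --> x.
Proof.
move=> FF [urysohnX minX] Fsep U; rewrite nbhsE => -[O [oO Ox] OU].
apply: filterS OU _; apply: contrapT => nFO; apply: minX.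
exists (Topological.class (coarsening x FF)); split.
  exact: (@urysohn_coarsening X x F FF).
by split=> [B []|/(_ O oO)[_ /(_ Ox)]].
Qed.

(** * From minimality to U-closedness *)

Lemma minimal_urysohn_U_closed (X : topologicalType) :
  minimal_urysohn X -> U_closed X.
Proof.
move=> minX; split=> [|Y f urysohnY [_ openf]]; first exact: minX.1.
move=> y cly; apply: contrapT => yf.
have fcont : continuous f.
  by apply/continuousP => A oA; apply/openf; exists A.
have cl_pre (B : set Y) : closure (f @^-1` B) `<=` f @^-1` closure B.
  move=> p clp N /fcont /clp[q [Bq Nq]]; by exists (f q).
pose F : set_system X := [set A | exists2 N, nbhs y N & f @^-1` N `<=` A].
have FF : Filter F.
  split.
  - by exists setT => //; exact: filterT.
  - move=> A B [N yN NA] [M yM MB]; exists (N `&` M); first exact: filterI.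
    by move=> p [/NA ? /MB].
  - by move=> A B AB [N yN NA]; exists N => //; exact: subset_trans NA AB.
have F0 : ~ F set0.
  by move=> [N /cly[_ [[p _ <-] Nfp]] /(_ p Nfp)].
have Fsep p : exists W V,
    [/\ open_nbhs p W, open V, F V & closure W `&` closure V = set0].
  have fpy : f p <> y by move=> fpy; apply: yf; exists p.
  have [U [V [Up Vy UV]]] := urysohnY _ _ fpy.
  exists (f @^-1` U°), (f @^-1` V°); split.
  - split=> //.
    by apply: open_comp; [move=> ? _; exact: fcont|exact: open_interior].
  - by apply: open_comp; [move=> ? _; exact: fcont|exact: open_interior].
  - by exists V° => //; exact: nbhs_interior.
  - rewrite -subset0 => q [/cl_pre Uq /cl_pre Vq].
    suff : (closure U `&` closure V) (f q) by rewrite UV.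
    by split; [apply: closureS Uq|apply: closureS Vq]; exact: interior_subset.
(* Any point of [X] will do: [F] converges to it by minimality, yet [Fsep] also holds there, which
   forces [set0] into [F]. *)
have [_ [[x _ _] _]] := cly setT filterT.
have cvgF : F --> x.
  by apply: minimal_urysohn_cvg => // p _; exact: Fsep.
have [W [V [Wx _ FV WV]]] := Fsep x.
apply: F0; apply: filterS (filterI (cvgF _ (open_nbhs_nbhs Wx)) FV).
by rewrite -WV => q [? ?]; split; exact: subset_closure.
Qed.

(** * From minimality to complete accumulation *)

Lemma theta_interiorP (X : topologicalType) (M : set X) (x : X) :
  theta_interior M x <-> exists2 U, open_nbhs x U & closure U `<=` M.
Proof.
split=> [/contrapT[U xU UM]|[U xU UM] /(_ _)]; last first.
  by apply; exists U => //; rewrite -subset0 => y [/UM].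
exists U => // y Uy; apply: contrapT => My.
by suff : (closure U `&` ~` M) y by rewrite UM.
Qed.

Lemma minimal_urysohn_complete_accumulation (X : topologicalType) (A : set X)
    (x : X) :
  minimal_urysohn X -> infinite_set A -> ~ theta2_converges A (~` [set x]) ->
  complete_accumulation_point A x.
Proof.
move=> minX infA /existsNP[gamma /not_implyP[[gopen gcov] nconv]].
split=> // U [oU Ux].
have large D : finite_set D -> D `<=` gamma ->
    A #<= A `\` \bigcup_(B in D) closure B.
  move=> finD Dg; apply: contrapT => nle; apply: nconv; exists D; split=> //.
  split; first exact: card_le_setD.
  by apply/negP => /card_eqPle[_].
pose F : set_system X := [set V | exists D, [/\ finite_set D, D `<=` gamma &
  ~` (\bigcup_(B in D) closure B) `<=` V]].
have FF : Filter F.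
  split.
  - by exists set0; split=> //; exact: finite_set0.
  - move=> V W [D [finD Dg DV]] [E [finE Eg EW]]; exists (D `|` E); split.
    + by rewrite finite_setU.
    + by move=> B [/Dg|/Eg].
    + rewrite bigcup_setU setCU => p [Dp Ep].
      by split; [exact: DV|exact: EW].
  - move=> V W VW [D [finD Dg DV]]; exists D; split=> //.
    exact: subset_trans DV VW.
have cvgF : F --> x.
  apply: minimal_urysohn_cvg => // y yx.
  have [B gB /theta_interiorP[W yW WB]] := gcov y yx.
  exists W, (~` closure B); split=> //.
  - by rewrite openC; exact: closed_closure.
  - exists [set B]; split=> //; first by move=> _ ->.
    by rewrite bigcup_set1.
  (* The open set [B] misses the complement of [closure B], hence also the closure of that
     complement. *)
  - rewrite -subset0 => p [/WB Bp].
    have /closureS clB : ~` closure B `<=` ~` B.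
      by apply: subsetC; exact: subset_closure.
    move=> /clB; rewrite closure_setC; apply.
    by apply: open_nbhs_nbhs; split=> //; exact: gopen.
have [D [finD Dg DU]] : F U by apply: cvgF; exact: open_nbhs_nbhs.
apply/card_eqPle; split; first by apply: subset_card_le; exact: subIsetl.
apply: card_le_trans (large _ finD Dg) _; apply: subset_card_le => p [Ap Dp].
by split=> //; exact: DU.
Qed.

(** * From complete accumulation to minimality *)

Lemma complete_accumulation_minimal_urysohn (X : topologicalType) :
  urysohn_space X ->
  (forall (A : set X) (x : X), infinite_set A ->
     ~ theta2_converges A (~` [set x]) ->
     complete_accumulation_point A x) ->
  minimal_urysohn X.
Proof.
move=> urysohnX accX; split=> // -[c [urysohnY [YX XY]]].
pose Y : topologicalType := Topological.Pack c.
apply: XY => U oU; rewrite (@openE Y) => x Ux.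
apply: contrapT => nU.
have clXY (B : set X) : @closure X B `<=` @closure Y B.
  move=> p clp N; rewrite nbhsE => -[O [oO Op] ON].
  have [|q [Bq Oq]] := clp O.
    by apply: open_nbhs_nbhs; split=> //; exact: YX.
  by exists q; split=> //; exact: ON.
pose gamma : set (set X) :=
  [set B | exists2 V, @open_nbhs Y x V & B = ~` (@closure Y V)].
have gcov : S1_cover gamma (~` [set x]).
  split=> [_ [V _ ->]|y yx].
    by apply: YX; rewrite (@openC Y); exact: closed_closure.
  have [W [V [Wy Vx WV]]] := urysohnY _ _ yx.
  exists (~` (@closure Y (@interior Y V))).
    exists (@interior Y V) => //; split; first exact: open_interior.
    exact: Vx.
  apply/theta_interiorP; exists (@interior Y W).
    by split; [apply: YX; exact: open_interior|exact: Wy].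
  move=> p /clXY Wp Vp; suff : (@closure Y W `&` @closure Y V) p by rewrite WV.
  by split; [apply: closureS Wp|apply: closureS Vp]; exact: interior_subset.
pose E : set (set X) := [set A | exists D, [/\ finite_set D, D `<=` gamma &
  A = ~` U `\` \bigcup_(B in D) closure B]].
(* The closure in [X] of a member of [gamma] misses the coarse neighbourhood [V] of [x] defining it.
   If finitely many such closures covered the complement of [U], then [U] would be a coarse
   neighbourhood of [x]. *)
have E_nonempty A : E A -> A !=set0.
  move=> [D [finD Dg ->]].
  have nD : @nbhs _ Y x (~` (\bigcup_(B in D) closure B)).
    rewrite setC_bigcup; have /finite_fsetP[D' DE] := finD; rewrite DE.
    apply: (@filter_bigI X (set X) D' _ _ (@nbhs_filter Y x)) => B BD'.
    have [|V [oV Vx] ->] := Dg B; first by rewrite DE.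
    apply: (@filterS _ _ (@nbhs_filter Y x) V); last exact: (@open_nbhs_nbhs Y).
    move=> p Vp; rewrite closure_setC; apply.
    apply: (@filterS _ _ (@nbhs_filter X p) V).
      exact: (@subset_closure Y).
    by apply: open_nbhs_nbhs; split=> //; exact: YX.
  apply/set0P/negP => /eqP UD; apply: nU.
  apply: (@filterS _ _ (@nbhs_filter Y x)) nD => p Dp.
  apply: contrapT => Up; suff : set0 p by [].
  by rewrite -UD.
have E_setD A D : E A -> finite_set D -> D `<=` gamma ->
    E (A `\` \bigcup_(B in D) closure B).
  move=> [D' [finD' Dg' ->]] finD Dg; exists (D' `|` D); split.
  - by rewrite finite_setU.
  - by move=> B [/Dg'|/Dg].
  - by rewrite bigcup_setU setDDl.
have [|A EA leastA] := @exists_least_card X E.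
  exists (~` U), set0; rewrite bigcup_set0 setD0.
  by split=> //; exact: finite_set0.
have AU : A `&` U = set0.
  by have [D [_ _ ->]] := EA; rewrite -subset0 => p [[]].
(* Choosing a member of [gamma] around each point of a finite [A] would leave an empty member of
   [E]. *)
have infA : infinite_set A.
  move=> finA.
  have [a|g gP] := @choice _ _ (fun a B => A a -> gamma B /\ closure B a).
    have [Aa|nAa] := pselect (A a); last by exists set0.
    have [ax|B gB /theta_interiorP[W [_ Wa] WB]] := gcov.2 a.
      suff : (A `&` U) a by rewrite AU.
      by rewrite ax in Aa *.
    by exists B => _; split=> //; apply: subset_closure; apply: WB;
      exact: subset_closure.
  have /E_nonempty[a [Aa]] : E (A `\` \bigcup_(B in g @` A) closure B).
    apply: E_setD => //; first exact: finite_image.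
    by move=> _ [a Aa <-]; exact: (gP a Aa).1.
  by apply; exists (g a); [exists a|exact: (gP a Aa).2].
(* Each remainder of [A] is again in [E], so leastness prevents a drop in cardinality. *)
have nconv : ~ theta2_converges A (~` [set x]).
  move=> /(_ gamma gcov)[D [finD Dg [_ /negP]]]; apply.
  apply/card_eqPle; split; first exact: card_le_setD.
  by apply: leastA; exact: E_setD.
have [_ /(_ U)] := accX A x infA nconv.
rewrite AU => /(_ (conj oU Ux)); rewrite card_eq_sym card_eq0.
by move=> /eqP A0; have [a] := E_nonempty A EA; rewrite A0.
Qed.

Theorem theorem5p4 (X : topologicalType) (urysohnX : urysohn_space X) :
  minimal_urysohn X <->
  U_closed X /\
  (forall (A : set X) (x : X), infinite_set A ->
     ~ theta2_converges A (~` [set x]) ->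
     complete_accumulation_point A x).
Proof.
split=> [minX|[_ accX]].
  split; first exact: minimal_urysohn_U_closed.
  by move=> A x; exact: minimal_urysohn_complete_accumulation.
exact: complete_accumulation_minimal_urysohn.
Qed.
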